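(* Let $P=(P_t)_{t\ge 0}$ and $\tilde P=(\tilde P_t)_{t\ge 0}$ be Markov semigroups on measurable spaces $(V,\mathcal V)$ and $(\tilde V,\tilde{\mathcal V})$. Assume that $P$ has an interweaving relation with $\tilde P$ with warm-up time $\tau$, where $\tau$ is infinitely divisible. Let $\boldsymbol\tau=(\tau_t)_{t\ge 0}$ be the subordinator such that $\tau_1$ has the same law as $\tau$, and let $P^{\boldsymbol\tau}=(P^{\boldsymbol\tau}_t)_{t\ge0}$ and $\tilde P^{\boldsymbol\tau}=(\tilde P^{\boldsymbol\tau}_t)_{t\ge0}$ be the subordinated Markov semigroups $$P^{\boldsymbol\tau}_t f=\int_0^\infty P_s f\,\mathbb P(\tau_t\in ds),\qquad \tilde P^{\boldsymbol\tau}_t f=\int_0^\infty \tilde P_s f\,\mathbb P(\tau_t\in ds)$$ for bounded measurable $f$ and $t\ge 0$. Then $P^{\boldsymbol\tau}$ has an interweaving relation with $\tilde P^{\boldsymbol\tau}$ with the deterministic warm-up time $1$.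
   Context: A Markov semigroup on a measurable space $(V,\mathcal V)$ is a family $P=(P_t)_{t\ge0}$ of Markov (probability) kernels from $V$ to $V$ such that $(t,x)\mapsto P_t(x,A)$ is measurable for every $A\in\mathcal V$ and $P_tP_s=P_{t+s}$ for all $s,t\ge0$ (composition of kernels). Kernels act on bounded measurable functions by $\Lambda f(x)=\int f(y)\Lambda(x,dy)$. $P$ has an interweaving relation with $\tilde P$ with warm-up time $\tau$ (a non-negative random variable) if there exist Markov kernels $\Lambda$ from $V$ to $\tilde V$ and $\tilde\Lambda$ from $\tilde V$ to $V$ such that for all $t\ge0$ $$P_t\Lambda=\Lambda\tilde P_t,\qquad \tilde P_t\tilde\Lambda=\tilde\Lambda P_t,\qquad \Lambda\tilde\Lambda=P_\tau:=\int_0^\infty P_t\,\mathbb P(\tau\in dt).$$ A deterministic warm-up time $t_0$ means $\tau=t_0$ almost surely. A non-negative random variable $\tau$ is infinitely divisible if for every $N\ge1$ it has the law of a sum of $N$ i.i.d. random variables. A subordinator is a non-decreasing L\'evy process started at $0$. *)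

(* Defs.v *)
From HB Require Import structures.
From mathcomp Require Import all_boot all_order all_algebra.
From mathcomp Require Import all_classical all_reals all_analysis.
From mathcomp Require Import measurable_realfun.

Set Implicit Arguments.
Unset Strict Implicit.
Unset Printing Implicit Defensive.

Import Order.TTheory GRing.Theory Num.Theory.
Import numFieldNormedType.Exports.

Local Open Scope classical_set_scope.
Local Open Scope ring_scope.
Local Open Scope ereal_scope.

(* Conventions.  Continuous time is indexed by the whole of R; only the indices
   t >= 0 are ever constrained or used, so the values of a family at negative
   times are junk.  Random variables are real-valued and "non-negative" means
   almost surely non-negative. *)

Section semigroups.
Context {R : realType}.

Record markov_semigroup d (V : measurableType d) (P : R -> R.-pker V ~> V)
    : Prop := MarkovSemigroup {
  semigroup_measurable : forall A : set V, measurable A ->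
    measurable_fun ([set tx : R * V | (0 <= tx.1)%R])
                   (fun tx : R * V => P tx.1 tx.2 A) ;
  semigroup_comp : forall s t : R, (0 <= s)%R -> (0 <= t)%R ->
    forall (x : V) (A : set V), measurable A ->
      kcomp_noparam (P t) (P s) x A = P (t + s)%R x A }.

(* The value at (x, A) of P_tau, the integral of P_t against the law of tau. *)
Definition random_time_kernel d (V : measurableType d) (P : R -> R.-pker V ~> V)
    dO (Omega : measurableType dO) (Pr : probability Omega R)
    (tau : {RV Pr >-> R}) (x : V) (A : set V) : \bar R :=
  \int[distribution Pr tau]_(t in `[0%R, +oo[) P t x A.

Definition interweaving d d' (V : measurableType d) (V' : measurableType d')
    (P : R -> R.-pker V ~> V) (P' : R -> R.-pker V' ~> V')
    dO (Omega : measurableType dO) (Pr : probability Omega R)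
    (tau : {RV Pr >-> R}) : Prop :=
  {ae Pr, forall w, (0 <= tau w)%R} /\
  exists (L : R.-pker V ~> V') (L' : R.-pker V' ~> V),
    [/\ forall t : R, (0 <= t)%R -> forall (x : V) (A : set V'), measurable A ->
          kcomp_noparam (P t) L x A = kcomp_noparam L (P' t) x A,
        forall t : R, (0 <= t)%R -> forall (x : V') (A : set V), measurable A ->
          kcomp_noparam (P' t) L' x A = kcomp_noparam L' (P t) x A
      & forall (x : V) (A : set V), measurable A ->
          kcomp_noparam L L' x A = random_time_kernel P tau x A].

(* The condition depends on tau only through its law, so quantifying over all
   almost surely constant tau or over a single one makes no difference. *)
Definition interweaving_deterministic
    d d' (V : measurableType d) (V' : measurableType d')
    (P : R -> R.-pker V ~> V) (P' : R -> R.-pker V' ~> V') (t0 : R) : Prop :=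
  forall (dO : measure_display) (Omega : measurableType dO)
    (Pr : probability Omega R) (tau : {RV Pr >-> R}),
    {ae Pr, forall w, tau w = t0} -> interweaving P P' tau.

End semigroups.

Section random_variables.
Context {R : realType}.

Definition same_law dO (Omega : measurableType dO) (Pr : probability Omega R)
    dO' (Omega' : measurableType dO') (Pr' : probability Omega' R)
    (Y : Omega -> R) (Z : Omega' -> R) : Prop :=
  forall B : set R, measurable B -> Pr (Y @^-1` B) = Pr' (Z @^-1` B).

(* Taking some B i to be setT yields the product rule for all subfamilies. *)
Definition mutually_independent dO (Omega : measurableType dO)
    (Pr : probability Omega R) (I : finType) (Y : I -> Omega -> R) : Prop :=
  forall B : I -> set R, (forall i, measurable (B i)) ->
    Pr (\bigcap_i (Y i @^-1` B i)) = \prod_(i : I) Pr (Y i @^-1` B i).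

Definition infinitely_divisible dO (Omega : measurableType dO)
    (Pr : probability Omega R) (tau : {RV Pr >-> R}) : Prop :=
  forall N : nat, (0 < N)%N ->
    exists (dO' : measure_display) (Omega' : measurableType dO')
      (Pr' : probability Omega' R) (Y : 'I_N -> {RV Pr' >-> R}),
      [/\ mutually_independent Pr' (fun i => Y i : Omega' -> R),
          forall i j, same_law Pr' Pr' (Y i) (Y j)
        & same_law Pr' Pr (fun w => \sum_(i < N) Y i w)%R tau].

(* Path regularity enters through continuity in probability, which for
   processes with stationary independent increments is implied by almost surely
   cadlag paths. *)
Record levy_process dO (Omega : measurableType dO) (Pr : probability Omega R)
    (X : R -> {RV Pr >-> R}) : Prop := LevyProcess {
  levy_independent_increments : forall (n : nat) (t : nat -> R),
    (0 <= t 0%N)%R -> (forall i, (t i <= t i.+1)%R) ->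
    mutually_independent Pr (fun (i : 'I_n) w => X (t i.+1) w - X (t i) w)%R ;
  levy_stationary_increments : forall s t : R, (0 <= s)%R -> (s <= t)%R ->
    same_law Pr Pr (fun w => X t w - X s w)%R
                   (fun w => X (t - s)%R w - X 0%R w)%R ;
  levy_continuous : forall t eps : R, (0 <= t)%R -> (0 < eps)%R ->
    Pr [set w | (eps < `|X s w - X t w|)%R]
      @[s --> within [set s : R | (0 <= s)%R] (nbhs t)] --> 0 }.

Record subordinator dO (Omega : measurableType dO) (Pr : probability Omega R)
    (X : R -> {RV Pr >-> R}) : Prop := Subordinator {
  subordinator_levy : levy_process X ;
  subordinator0 : {ae Pr, forall w, X 0%R w = 0%R} ;
  subordinator_nondecreasing : {ae Pr, forall w,
    forall s t : R, (0 <= s)%R -> (s <= t)%R -> (X s w <= X t w)%R} }.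

(* On bounded measurable f, Q_t f is the integral of P_s f against the law of
   X_t; this determines the kernel Q t for every t >= 0. *)
Definition subordinated d (V : measurableType d)
    dO (Omega : measurableType dO) (Pr : probability Omega R)
    (P : R -> R.-pker V ~> V) (X : R -> {RV Pr >-> R})
    (Q : R -> R.-pker V ~> V) : Prop :=
  forall t : R, (0 <= t)%R ->
  forall f : V -> R, measurable_fun setT f ->
    (exists M : R, forall y, (`|f y| <= M)%R) ->
  forall x : V,
    \int[Q t x]_y (f y)%:E =
    \int[distribution Pr (X t)]_(s in `[0%R, +oo[) \int[P s x]_y (f y)%:E.

End random_variables.

(* Main.v *)
(* Every relation between P and P~ survives integration in time against the law mu_t of
   tau_t.  Integrating P_s Lambda = Lambda P~_s and exchanging the order of integration
   gives P^tau_t Lambda = Lambda P~^tau_t, and symmetrically for Lambda~.  Since tau_s and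
   tau_(s+t) - tau_s are independent with laws mu_s and mu_t, mu_s * mu_t = mu_(s+t), so
   P^tau is again a semigroup.  Finally tau_1 has the law of tau, hence
   Lambda Lambda~ = P_tau = P^tau_1, which is the warm-up relation at time 1. *)

Require Import Defs.
From HB Require Import structures.
From mathcomp Require Import all_boot all_order all_algebra.
From mathcomp Require Import all_classical all_reals all_analysis.
From mathcomp Require Import measurable_realfun.

Set Implicit Arguments.
Unset Strict Implicit.
Unset Printing Implicit Defensive.

Import Order.TTheory GRing.Theory Num.Theory.
Import numFieldNormedType.Exports.

Local Open Scope classical_set_scope.
Local Open Scope ring_scope.

(** * Building probability kernels and comparing measures of sets *)

Lemma prob_kernel_exists d d' (X : measurableType d) (Y : measurableType d')
    (R : realType) (k : X -> {measure set Y -> \bar R}) :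
  (forall U, measurable U -> measurable_fun [set: X] (k ^~ U)) ->
  (forall x, k x [set: Y] = 1%E) ->
  exists K : R.-pker X ~> Y, forall x, K x = k x.
Proof.
move=> mk k1.
pose mk' := isKernel.Build _ _ _ _ _ k mk.
pose ker : R.-ker X ~> Y := HB.pack k mk'.
pose pk' := Kernel_isProbability.Build _ _ _ _ _ ker k1.
pose pker : R.-pker X ~> Y := HB.pack k mk' pk'.
by exists pker.
Qed.

(** Serves to freeze, drop or permute the arguments of a kernel without leaving the type of
    probability kernels. *)
Lemma precomp_kernel_exists d1 d2 d3 (X : measurableType d1)
    (Y : measurableType d2) (Z : measurableType d3) (R : realType)
    (k : R.-pker Y ~> Z) (f : X -> Y) : measurable_fun setT f ->
  exists K : R.-pker X ~> Z, forall x, K x = k (f x).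
Proof.
move=> mf; apply: (@prob_kernel_exists _ _ _ _ _ (fun x => k (f x))).
- move=> U mU; exact: measurableT_comp (measurable_kernel k _ mU) mf.
- by move=> x; exact: prob_kernel.
Qed.

(* [K (s, x)] is [P (max s 0) x]: joint measurability is only assumed at s >= 0. *)
Lemma markov_semigroup_kernel (R : realType) d (V : measurableType d)
    (P : R -> R.-pker V ~> V) : markov_semigroup P ->
  exists K : R.-pker (R * V)%type ~> V,
    forall s x, 0 <= s -> K (s, x) = P s x.
Proof.
case=> mP _.
have [||K KE] := @prob_kernel_exists _ _ (R * V)%type V R
  (fun sx => P (Num.max sx.1 0) sx.2).
- move=> U mU.
  pose g (sx : R * V) := (Num.max sx.1 0, sx.2).
  apply: (@measurable_comp _ _ _ _ _ _ _ (fun tx => P tx.1 tx.2 U) _ g) (mP U mU) _.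
  + rewrite (_ : mkset _ = fst @^-1` `[0, +oo[).
      by rewrite -[_ @^-1` _]setTI; exact: measurable_fst.
    by apply/seteqP; split => -[s x] /=; rewrite in_itv/= andbT.
  + by move=> _ [[s x] _ <-] /=; rewrite le_max lexx orbT.
  + apply/measurable_fun_pairP; split; last exact: measurable_snd.
    by apply: measurable_maxr => //; exact: measurable_fst.
- by move=> x; exact: prob_kernel.
by exists K => s x s0; rewrite KE/= max_l.
Qed.

Lemma ae_subset_le_measure d (T : measurableType d) (R : realType)
    (mu : {measure set T -> \bar R}) (A B : set T) :
  measurable A -> measurable B -> {ae mu, forall x, A x -> B x} ->
  (mu A <= mu B)%E.
Proof.
move=> mA mB AB.
have mAB : measurable (A `\` B) by exact: measurableD.
have AB0 : mu (A `\` B) = 0%E.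
  apply/(measure_negligible mAB); apply: negligibleS AB => x [Ax nBx] /=.
  by move=> /(_ Ax).
apply: (@le_trans _ _ (mu (B `|` (A `\` B)))).
  apply: le_measure; rewrite ?inE//; first exact: measurableU.
  by move=> x Ax; have [|] := pselect (B x); [left|right].
by apply: le_trans (measureU2 mu mB mAB) _; rewrite [X in (_ + X)%E]AB0 adde0.
Qed.

Lemma ae_eqset_measure d (T : measurableType d) (R : realType)
    (mu : {measure set T -> \bar R}) (A B : set T) :
  measurable A -> measurable B -> {ae mu, forall x, A x <-> B x} ->
  mu A = mu B.
Proof.
move=> mA mB AB; apply/eqP; rewrite eq_le; apply/andP; split.
  by apply: ae_subset_le_measure => //; apply: filterS AB => x [].
by apply: ae_subset_le_measure => //; apply: filterS AB => x [].
Qed.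

(** By Dynkin's theorem: the sets [A] with [k x A] measurable in [x] form a Dynkin system, total
    mass 1 giving complements through [1 - k x S] and disjoint unions giving countable sums. *)
Lemma measurable_probability_family d d' (X : measurableType d)
    (Y : measurableType d') (R : realType) (G : set (set Y))
    (k : X -> probability Y R) :
  @measurable _ Y = <<s G >> -> setI_closed G ->
  (forall A, G A -> measurable_fun [set: X] (fun x => k x A)) ->
  forall A, measurable A -> measurable_fun [set: X] (fun x => k x A).
Proof.
move=> mE GI kG A; rewrite {1}mE; move: A.
apply: (@dynkin_induction _ Y G (fun A => measurable_fun [set: X] (fun x => k x A))) => //.
- rewrite (_ : (fun _ => _) = cst 1%E)//.
  by apply/funext => x /=; exact: probability_setT.
- move=> S mS ih; rewrite (_ : (fun _ => _) = (fun x => 1 - k x S)%E).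
    exact: emeasurable_funB.
  by apply/funext => x; rewrite probability_setC.
- move=> F mF tF ih.
  rewrite (_ : (fun _ => _) = (fun x => \sum_(n <oo) k x (F n))%E).
    by apply: ge0_emeasurable_sum.
  apply/funext => x; rewrite measure_semi_bigcup//.
  exact: bigcup_measurable.
Qed.

(** * One-dimensional laws of a subordinator and their convolution *)

Section subordinator_laws.
Context {R : realType} {d} {Omega : measurableType d} {Pr : probability Omega R}
  {X : R -> {RV Pr >-> R}} (subX : subordinator X).

Lemma subordinator_ge0 t : 0 <= t -> {ae Pr, forall w, 0 <= X t w}.
Proof.
move=> t0; have [_ X0 Xnd] := subX.
by apply: filterS2 X0 Xnd => w X0w /(_ _ _ (lexx 0) t0); rewrite X0w.
Qed.

Lemma subordinator_law_lt0 t : 0 <= t -> distribution Pr (X t) `]-oo, 0[ = 0%E.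
Proof.
move=> t0.
have mXt : measurable (X t @^-1` `]-oo, 0[%classic).
  exact: measurable_funPTI.
apply/(measure_negligible mXt).
apply: negligibleS (subordinator_ge0 t0) => w /=.
by rewrite in_itv/= => Xt0; apply/negP; rewrite -ltNge.
Qed.

(* The paths are non-decreasing, so P(X_t >= x) is monotone, hence measurable, in t. *)
Lemma subordinator_law_kernel :
  exists mu : R.-pker R ~> R, forall t, 0 <= t -> mu t = distribution Pr (X t).
Proof.
have [_ _ Xnd] := subX.
have mX t A : measurable A -> measurable (X t @^-1` A).
  exact: measurable_funPTI.
have [||mu muE] := @prob_kernel_exists _ _ R R R
  (fun t => distribution Pr (X (Num.max t 0))).
(* The closed rays [[x, +oo[] generate the Borel sets, and two of them meet in the ray from the
   larger endpoint. *)
- apply: (@measurable_probability_family _ _ R R R (@RGenCInfty.G R)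
    (fun t => distribution Pr (X (Num.max t 0)))).
  + exact: RGenCInfty.measurableE.
  + move=> _ _ [x ->] [y ->]; exists (Num.max x y).
    apply/seteqP; split => z; rewrite /= !in_itv/= !andbT ge_max.
      by move=> [-> ->].
    by move/andP.
  + move=> _ [x ->] /=.
    rewrite (_ : (fun _ => _) =
        EFin \o (fun t => fine (Pr (X (Num.max t 0) @^-1` `[x, +oo[)))); last first.
      by apply/funext => t /=; rewrite fineK// fin_num_measure//; exact: mX.
    (* Truncating time at 0 preserves the order, so the tail probability is monotone on all of R. *)
    apply/measurable_EFinP; apply: nondecreasing_measurable => // s t st.
    rewrite fine_le ?fin_num_measure//; [exact: mX|exact: mX|].
    apply: ae_subset_le_measure; [exact: mX|exact: mX|].
    apply: filterS Xnd => w Xw /=; rewrite !in_itv/= !andbT => /le_trans; apply.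
    by apply: Xw; [rewrite le_max lexx orbT|rewrite ge_max !le_max st lexx orbT].
- by move=> t; exact: probability_setT.
by exists mu => t t0; rewrite muE max_l.
Qed.

(** The pair of [X s] and [X (s + t) - X s] has the product law, by independence and stationarity of
    increments, and its coordinates add up to [X (s + t)]. *)
Lemma subordinator_convolution (s t : R) (A : set R) :
  0 <= s -> 0 <= t -> measurable A ->
  (distribution Pr (X s) \x distribution Pr (X t))%E
    [set z : R * R | A (z.1 + z.2)] = distribution Pr (X (s + t)) A.
Proof.
move=> s0 t0 mA.
have [[indep stat _] X0 _] := subX.
have mX r B : measurable B -> measurable (X r @^-1` B).
  exact: measurable_funPTI.
have mXB u v : measurable_fun setT (fun w => X u w - X v w).
  exact: measurable_funB.
have law_incr B : measurable B ->
    Pr ((fun w => X (s + t) w - X s w) @^-1` B) = distribution Pr (X t) B.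
  move=> mB; rewrite (stat s (s + t))//; last by rewrite lerDl.
  rewrite addrAC subrr add0r.
  apply: ae_eqset_measure.
  - by rewrite -[_ @^-1` _]setTI; exact: mXB.
  - exact: mX.
  - by apply: filterS X0 => w X0w /=; rewrite X0w subr0.
pose Y w := (X s w, X (s + t) w - X s w).
have mY : measurable_fun setT Y.
  by apply/measurable_fun_pairP; split; [exact: (measurable_funPT (X s))|exact: mXB].
pose Y' : {mfun Omega >-> (R * R)%type} := HB.pack Y (isMeasurableFun.Build _ _ _ _ _ mY).
(* The law of the pair [Y] is the product measure as soon as both agree on rectangles. *)
rewrite (@product_measure_unique _ _ _ _ _ (distribution Pr (X s))
  (distribution Pr (X t)) (distribution Pr Y')).
- rewrite /distribution /pushforward; congr (Pr _).
  by apply/seteqP; split => w /=; rewrite subrKC.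
- move=> B C mB mC.
  (* The two increments in play are over [0, s] and [s, s + t]; past index 2 the sequence stays
     constant, which keeps it non-decreasing. *)
  pose ti (n : nat) := match n with 0%N => 0 | 1%N => s | _ => s + t end.
  pose D (i : 'I_2) := if i == ord0 then B else C.
  have tiS i : ti i <= ti i.+1 by case: i => [|[|i]] //=; rewrite lerDl.
  have mD i : measurable (D i) by rewrite /D; case: ifP.
  have := indep 2%N ti (lexx 0) tiS D mD.
  rewrite big_ord_recl big_ord1 /D/= law_incr// => H.
  transitivity (Pr (X s @^-1` B `&` (fun w => X (s + t) w - X s w) @^-1` C)).
    by congr (Pr _); apply/seteqP; split => w.
  have mXBpre u v E : measurable E -> measurable ((fun w => X u w - X v w) @^-1` E).
    by move=> mE; rewrite -[_ @^-1` _]setTI; exact: mXB.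
  (* Independence speaks of [X s - X 0], which equals [X s] only almost surely. *)
  have -> : distribution Pr (X s) B = Pr ((fun w => X s w - X 0 w) @^-1` B).
    apply: (@ae_eqset_measure _ _ _ Pr (X s @^-1` B)); [exact: mX|exact: mXBpre|].
    by apply: filterS X0 => w X0w /=; rewrite X0w subr0.
  rewrite -H; transitivity (Pr ((fun w => X s w - X 0 w) @^-1` B `&`
      (fun w => X (s + t) w - X s w) @^-1` C)).
    apply: ae_eqset_measure.
    + by apply: measurableI; [exact: mX|exact: mXBpre].
    + by apply: measurableI; exact: mXBpre.
    + by apply: filterS X0 => w X0w /=; rewrite X0w subr0.
  congr (Pr _); apply/seteqP; split => w /=.
    by move=> [Bw Cw] [[|[|//]] i2] _ /=.
  by move=> Hw; split; [exact: (Hw ord0)|exact: (Hw ord_max)].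
- rewrite -[mkset _]setTI.
  by apply: (measurable_funD measurable_fst measurable_snd).
Qed.

End subordinator_laws.

(** * Integration over non-negative times, mixtures of kernels and Tonelli's theorem *)

Lemma integral_nneg_support (R : realType) (m : {measure set R -> \bar R})
    (f : R -> \bar R) :
  measurable_fun setT f -> m `]-oo, 0[%classic = 0%E ->
  (\int[m]_s f s = \int[m]_(s in `[0%R, +oo[) f s)%E.
Proof.
move=> mf m0.
(* For a non-negative integrand the null half-line can be discarded; the general case follows on
   positive and negative parts. *)
have ge0_case (g : R -> \bar R) : measurable_fun setT g ->
    (forall s, 0 <= g s)%E -> (\int[m]_s g s = \int[m]_(s in `[0%R, +oo[) g s)%E.
  move=> mg g0; rewrite (@ge0_negligible_integral _ R R m setT `]-oo, 0[%classic)//.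
  by rewrite setTD setCitvl.
rewrite integralE [RHS]integralE; congr (_ - _)%E; apply: ge0_case => //.
  exact: measurable_funepos.
exact: measurable_funeneg.
Qed.

(** Realising the mixture as a composition of kernels makes it jointly measurable in time and point
    at once. *)
Lemma subordinate_kernel_exists (R : realType) d (V : measurableType d)
    (K : R.-pker (R * V)%type ~> V) (mu : R.-pker R ~> R) :
  exists KQ : R.-pker (R * V)%type ~> V,
    (forall t x A, KQ (t, x) A = \int[mu t]_s K (s, x) A)%E /\
    (forall t x (f : V -> \bar R), (forall y, 0 <= f y)%E ->
      measurable_fun setT f ->
      \int[KQ (t, x)]_y f y = \int[mu t]_s \int[K (s, x)]_y f y)%E.
Proof.
(* From (t, x), [l] draws a time s from [mu t]; then [k] moves x by [K (s, x)], forgetting t. *)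
have [l lE] := @precomp_kernel_exists _ _ _ (R * V)%type R R R mu fst
  measurable_fst.
have [k kE] := @precomp_kernel_exists _ _ _ ((R * V) * R)%type (R * V)%type V R K
  (fun z => (z.2, z.1.2)) ltac:(by apply/measurable_fun_pairP; split;
    [exact: measurable_snd|exact: (measurableT_comp measurable_snd measurable_fst)]).
have [||KQ KQE] := @prob_kernel_exists _ _ (R * V)%type V R (l \; k)%E.
- by move=> U mU; exact: measurable_kernel.
- move=> x; rewrite /mkcomp/= /kcomp.
  under eq_integral do rewrite prob_kernel.
  by rewrite integral_cst// mul1e prob_kernel.
exists KQ; split=> [t x A|t x f f0 mf].
  by rewrite KQE /mkcomp/= /kcomp lE/=; apply: eq_integral => s _; rewrite kE.
rewrite KQE /mkcomp integral_kcomp// (eq_measure_integral (mu t)).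
  apply: eq_integral => s _; apply: eq_measure_integral => A _ _.
  exact: (congr1 (fun m : {measure set V -> \bar R} => m A) (kE (t, x, s))).
by move=> A _ _; exact: (congr1 (fun m : {measure set R -> \bar R} => m A) (lE (t, x))).
Qed.

(** The value of a kernel at a point is typed as a bare measure; this restores the probability
    structure under which Tonelli's theorem applies. *)
Lemma measure_probability d (Y : measurableType d) (R : realType)
    (m : {measure set Y -> \bar R}) : m [set: Y] = 1%E ->
  exists p : probability Y R, p = m :> {measure set Y -> \bar R}.
Proof.
case: m => f c m1; pose m : {measure set Y -> \bar R} := Measure.Pack c.
pose pr := Measure_isProbability.Build _ _ _ m m1.
pose p : probability Y R := HB.pack f c pr.
by exists p.
Qed.

Lemma fubini_tonelli_kernel d1 d2 d3 d4 (X : measurableType d1)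
    (Y : measurableType d2) (X' : measurableType d3) (Y' : measurableType d4)
    (R : realType) (k : R.-pker X ~> Y) (k' : R.-pker X' ~> Y') x x'
    (f : Y * Y' -> \bar R) :
  measurable_fun setT f -> (forall z, 0 <= f z)%E ->
  (\int[k x]_y \int[k' x']_z f (y, z) = \int[k' x']_z \int[k x]_y f (y, z))%E.
Proof.
move=> mf f0.
have [p <-] := measure_probability (prob_kernel (s:=k) x).
have [p' <-] := measure_probability (prob_kernel (s:=k') x').
exact: fubini_tonelli.
Qed.

Lemma measurable_integral_kernel d1 d2 d3 (X : measurableType d1)
    (Y : measurableType d2) (Z : measurableType d3) (R : realType)
    (k : R.-pker X ~> Y) x (f : Y * Z -> \bar R) :
  measurable_fun setT f -> (forall z, 0 <= f z)%E ->
  measurable_fun setT (fun z => \int[k x]_y f (y, z))%E.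
Proof.
move=> mf f0; have [p <-] := measure_probability (prob_kernel (s:=k) x).
exact: measurable_fun_fubini_tonelli_G.
Qed.

(** * Subordinated kernels: existence, semigroup property and intertwining *)

Section subordination.
Context {R : realType} {dS} {OmegaS : measurableType dS}
  {PrS : probability OmegaS R} {X : R -> {RV PrS >-> R}} (subX : subordinator X)
  (mu : R.-pker R ~> R) (muE : forall t : R, 0 <= t -> mu t = distribution PrS (X t)).

Lemma integral_law (t : R) (f : R -> \bar R) : 0 <= t -> measurable_fun setT f ->
  (\int[mu t]_s f s = \int[distribution PrS (X t)]_(s in `[0%R, +oo[) f s)%E.
Proof.
move=> t0 mf; rewrite muE//; apply: integral_nneg_support => //.
exact: subordinator_law_lt0.
Qed.

(** The law [mu t] does not charge negative times, so junk values there are harmless and identities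
    of semigroups are needed only at s >= 0. *)
Lemma eq_integral_law (t : R) (f g : R -> \bar R) : 0 <= t ->
  measurable_fun setT f -> measurable_fun setT g ->
  (forall s, 0 <= s -> f s = g s) ->
  (\int[mu t]_s f s = \int[mu t]_s g s)%E.
Proof.
move=> t0 mf mg fg; rewrite !integral_law//; apply: eq_integral => s.
by rewrite inE/= in_itv/= andbT => /fg.
Qed.

(* [K] is the semigroup [P] and [KQ] its subordination, both as kernels jointly in
   (time, point); only their values at times t >= 0 are tied to [P] and [X]. *)
Record subordination_kernels d (V : measurableType d) (P : R -> R.-pker V ~> V)
    (K KQ : R.-pker (R * V)%type ~> V) : Prop := SubordinationKernels {
  time_kernelE : forall (s : R) x, 0 <= s -> K (s, x) = P s x ;
  subordinate_kernelE : forall (t : R) x A,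
    (KQ (t, x) A = \int[mu t]_s K (s, x) A)%E ;
  integral_subordinate_kernel : forall (t : R) x (f : V -> \bar R),
    (forall y, 0 <= f y)%E -> measurable_fun setT f ->
    (\int[KQ (t, x)]_y f y = \int[mu t]_s \int[K (s, x)]_y f y)%E }.

Lemma subordination_kernels_exist d (V : measurableType d)
    (P : R -> R.-pker V ~> V) :
  markov_semigroup P -> exists K KQ, subordination_kernels P K KQ.
Proof.
move=> /markov_semigroup_kernel[K KE].
by have [KQ [KQE intKQ]] := subordinate_kernel_exists K mu; exists K, KQ.
Qed.

Section subordinate_semigroup.
Context {d} {V : measurableType d} {P : R -> R.-pker V ~> V}
  {K KQ : R.-pker (R * V)%type ~> V} (kerP : subordination_kernels P K KQ).

Let KE := time_kernelE kerP.
Let KQE := subordinate_kernelE kerP.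
Let integralKQ := integral_subordinate_kernel kerP.

Lemma measurable_slice (U : set V) x : measurable U ->
  measurable_fun setT (fun s => K (s, x) U).
Proof.
move=> mU; exact: (measurableT_comp (measurable_kernel K _ mU) (pair2_measurable x)).
Qed.

Lemma measurable_integral_slice (f : V -> \bar R) x :
  (forall y, 0 <= f y)%E -> measurable_fun setT f ->
  measurable_fun setT (fun s => \int[K (s, x)]_y f y)%E.
Proof.
move=> f0 mf; apply: (@measurable_fun_integral_kernel _ _ _ _ _ (fun s => K (s, x))) => //.
by move=> U mU; exact: measurable_slice.
Qed.

(** Obtained by testing on indicators. It lets every later computation on [Q] take place on the
    jointly measurable [KQ]. *)
Lemma subordinated_kernelE Q : subordinated P X Q ->
  forall t x A, 0 <= t -> measurable A -> Q t x A = KQ (t, x) A.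
Proof.
move=> subQ t x A t0 mA.
have := subQ t t0 (\1_A) (measurable_indic mA) _ x.
rewrite integral_indic// setIT => ->; last first.
  by exists 1 => y; rewrite indicE; case: (_ \in _); rewrite ?normr1 ?normr0.
rewrite KQE integral_law//; last exact: measurable_slice.
apply: eq_integral => s; rewrite inE/= in_itv/= andbT => s0.
by rewrite integral_indic// setIT KE.
Qed.

(** The slices of [KQ] work. Its integral formula covers non-negative functions, so a bounded [f] is
    split into its two parts, whose integrals are finite and can be subtracted. *)
Lemma subordinated_exists : exists Q, subordinated P X Q.
Proof.
have /choice[Q QE] t := @precomp_kernel_exists _ _ _ V (R * V)%type V R KQ _
  (pair1_measurable t).
exists Q => t t0 f mf [M fM] x; rewrite QE.
have bounded_int (g : V -> \bar R) : measurable_fun setT g ->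
    (forall y, 0 <= g y <= M%:E)%E ->
    (mu t).-integrable setT (fun s => \int[K (s, x)]_y g y)%E.
  move=> mg g0M; have g0 y : (0 <= g y)%E by have /andP[] := g0M y.
  apply: (@le_integrable _ _ _ _ _ measurableT _ (EFin \o cst M)).
  - exact: measurable_integral_slice.
  - move=> s _; rewrite gee0_abs ?integral_ge0//=.
    apply: (@le_trans _ _ (\int[K (s, x)]_y cst M%:E y)%E).
      by apply: ge0_le_integral => // y _; have /andP[] := g0M y.
    by rewrite integral_cst// prob_kernel mule1 lee_fin ler_norm.
  - apply/integrableP; split; first exact/measurable_EFinP.
    rewrite (eq_integral (cst `|M|%:E))// integral_cst// prob_kernel mule1.
    exact: ltry.
(* A measurable type is pointed, so the bound can be evaluated somewhere. *)
have M0 : 0 <= M by apply: le_trans (fM point).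
have fp y : (0 <= (EFin \o f)^\+ y <= M%:E)%E.
  rewrite funepos_ge0 funeposE/= ge_max !lee_fin M0 andbT.
  by rewrite (le_trans (ler_norm _) (fM y)).
have fn y : (0 <= (EFin \o f)^\- y <= M%:E)%E.
  rewrite funeneg_ge0 funenegE/= ge_max !lee_fin M0 andbT.
  by rewrite (le_trans _ (fM y))// -normrN ler_norm.
have mfE : measurable_fun setT (EFin \o f) by exact/measurable_EFinP.
have ip := bounded_int _ (measurable_funepos mfE) fp.
have im := bounded_int _ (measurable_funeneg mfE) fn.
rewrite integralE !integralKQ//; [|exact: measurable_funeneg|exact: measurable_funepos].
rewrite -integralB// integral_law//; last first.
  by apply: emeasurable_funB; [have /integrableP[] := ip|have /integrableP[] := im].
apply: eq_integral => s; rewrite inE/= in_itv/= andbT => s0.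
by rewrite !KE// [RHS]integralE.
Qed.

(** Both sides reduce to integrals of [K (w, x) A]: on the left w = u + v with (u, v) under the
    product of the laws of [X t] and [X s], on the right w under the law of [X (t + s)]. *)
Lemma subordinated_semigroup Q :
  markov_semigroup P -> subordinated P X Q -> markov_semigroup Q.
Proof.
move=> [_ Pcomp] subQ; have QE := subordinated_kernelE subQ; split.
  move=> A mA.
  (* Joint measurability is inherited from [KQ], which agrees with [Q] at times t >= 0. *)
  apply: (@eq_measurable_fun _ _ _ _ _ (fun tx : R * V => KQ tx A)).
    by move=> [t x]; rewrite inE/= => t0; rewrite QE.
  exact/measurable_funTS/measurable_kernel.
move=> s t s0 t0 x A mA.
have mKQ r : measurable_fun setT (fun y => KQ (r, y) A).
  exact: (measurableT_comp (measurable_kernel KQ _ mA) (pair1_measurable r)).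
have mKA := measurable_kernel K _ mA.
pose F (z : R * R) := K (z.1 + z.2, x) A.
have mD : measurable_fun setT (fun z : R * R => z.1 + z.2).
  exact: measurable_funD measurable_fst measurable_snd.
have mF : measurable_fun setT F.
  exact: (measurableT_comp (measurable_slice x mA) mD).
rewrite /kcomp_noparam (eq_measure_integral (KQ (t, x))); last first.
  by move=> B mB _; exact: QE.
transitivity (\int[KQ (t, x)]_y KQ (s, y) A)%E.
  by apply: eq_integral => y _; exact: QE.
rewrite integralKQ//.
(* For u >= 0, exchanging the integrals in y and v exposes the composition of [P u] and [P v], which
   is [P (u + v)]. *)
rewrite (@eq_integral_law _ _ (fun u => \int[mu s]_v F (u, v))%E)//; first last.
- move=> u u0.
  under eq_integral do rewrite KQE.
  rewrite (@fubini_tonelli_kernel _ _ _ _ _ _ _ _ _ K mu (u, x) s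
    (fun z => K (z.2, z.1) A)) //; last first.
    by apply: (measurableT_comp mKA); apply/measurable_fun_pairP; split;
      [exact: measurable_snd|exact: measurable_fst].
  apply: eq_integral_law => //.
  + apply: (@measurable_integral_kernel _ _ _ _ _ _ _ K (u, x) (fun z => K (z.2, z.1) A)) => //.
    by apply: (measurableT_comp mKA); apply/measurable_fun_pairP; split;
      [exact: measurable_snd|exact: measurable_fst].
  + exact: (measurableT_comp mF (pair1_measurable u)).
  + move=> v v0.
    transitivity (P (u + v) x A); last by rewrite /F/= KE ?addr_ge0.
    rewrite -Pcomp// /kcomp_noparam KE//.
    by apply: eq_integral => y _; rewrite KE.
- by rewrite muE//; exact: measurable_fun_fubini_tonelli_F.
- exact: measurable_integral_slice.
rewrite QE ?addr_ge0// KQE !muE ?addr_ge0//.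
(* The iterated integral becomes one over the product law, then over its image under addition. *)
rewrite -(@fubini_tonelli1 _ _ _ _ _ _ _ F)//.
transitivity (\int[pushforward (distribution PrS (X t) \x distribution PrS (X s))
  (fun z : R * R => z.1 + z.2)%R]_w K (w, x) A)%E.
  by rewrite ge0_integral_pushforward//; exact: measurable_slice.
apply: eq_measure_integral => B mB _.
exact: (subordinator_convolution subX).
Qed.

End subordinate_semigroup.

(** Stated for one direction and a generic [L], so that exchanging the two semigroups yields the
    other relation. *)
Lemma subordinated_intertwining d1 d2 (V : measurableType d1) (W : measurableType d2)
    (P : R -> R.-pker V ~> V) (P' : R -> R.-pker W ~> W) K KQ K' KQ' Q Q'
    (L : R.-pker V ~> W) :
  subordination_kernels P K KQ -> subordination_kernels P' K' KQ' ->
  subordinated P X Q -> subordinated P' X Q' ->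
  (forall t : R, 0 <= t -> forall x A, measurable A ->
    kcomp_noparam (P t) L x A = kcomp_noparam L (P' t) x A) ->
  forall t : R, 0 <= t -> forall x A, measurable A ->
    kcomp_noparam (Q t) L x A = kcomp_noparam L (Q' t) x A.
Proof.
move=> kerP kerP' subQ subQ' PL t t0 x A mA; rewrite /kcomp_noparam.
have mK' : measurable_fun setT (fun z : W * R => K' (z.2, z.1) A).
  by apply: (measurableT_comp (measurable_kernel K' _ mA));
    apply/measurable_fun_pairP; split; [exact: measurable_snd|exact: measurable_fst].
transitivity (\int[KQ (t, x)]_y L y A)%E.
  apply: eq_measure_integral => B mB _; exact: (subordinated_kernelE kerP).
rewrite (integral_subordinate_kernel kerP)//; last exact: measurable_kernel.
transitivity (\int[L x]_y KQ' (t, y) A)%E; last first.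
  by apply: eq_integral => y _; rewrite (subordinated_kernelE kerP').
under [RHS]eq_integral do rewrite (subordinate_kernelE kerP').
(* With the time integral outermost on both sides, the relation at each fixed s >= 0 concludes. *)
rewrite (@fubini_tonelli_kernel _ _ _ _ _ _ _ _ _ L mu x t
    (fun z => K' (z.2, z.1) A)) //.
apply: eq_integral_law => //.
- by apply: measurable_integral_slice => //; exact: measurable_kernel.
- exact: (@measurable_integral_kernel _ _ _ _ _ _ _ L x (fun z => K' (z.2, z.1) A)).
- move=> s s0.
  rewrite (time_kernelE kerP)//.
  have := PL s s0 x A mA; rewrite /kcomp_noparam => ->.
  by apply: eq_integral => y _; rewrite (time_kernelE kerP').
Qed.

End subordination.

(** * The warm-up relation and the conclusion *)

Lemma subordinated_interweaving_deterministic (R : realType) d1 d2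
    (V : measurableType d1) (W : measurableType d2)
    (P : R -> R.-pker V ~> V) (P' : R -> R.-pker W ~> W)
    dO (Omega : measurableType dO) (Pr : probability Omega R) (tau : {RV Pr >-> R})
    dS (OmegaS : measurableType dS) (PrS : probability OmegaS R)
    (X : R -> {RV PrS >-> R}) Q Q' :
  markov_semigroup P -> markov_semigroup P' -> interweaving P P' tau ->
  subordinator X -> same_law PrS Pr (X 1) tau ->
  subordinated P X Q -> subordinated P' X Q' ->
  interweaving_deterministic Q Q' 1.
Proof.
move=> sgP sgP' [_ [L [L' [PL P'L' LL']]]] subX X1tau subQ subQ'.
move=> dO1 Omega1 Pr1 sigma sigma1.
have [mu muE] := subordinator_law_kernel subX.
have [K [KQ kerP]] := subordination_kernels_exist mu sgP.
have [K' [KQ' kerP']] := subordination_kernels_exist mu sgP'.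
split; first by apply: filterS sigma1 => w ->.
(* The same two kernels interweave the subordinated semigroups. *)
exists L, L'; split.
- exact: (subordinated_intertwining subX muE kerP kerP').
- exact: (subordinated_intertwining subX muE kerP' kerP).
move=> x A mA.
have QE t : 0 <= t -> Q t x A = KQ (t, x) A.
  by move=> t0; exact: (subordinated_kernelE subX muE kerP).
(* Both sides are compared with time 1: on the left [tau] has the law of [X 1], on the right [sigma]
   is almost surely 1. *)
transitivity (KQ (1, x) A).
  rewrite LL'// (subordinate_kernelE kerP).
  rewrite (integral_law subX muE)//; last exact: measurable_slice.
  rewrite /random_time_kernel (eq_measure_integral (distribution PrS (X 1))).
    apply: eq_integral => s; rewrite inE/= in_itv/= andbT => s0.
    by rewrite (time_kernelE kerP).
  by move=> B mB _; exact/esym/X1tau.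
have mKQ : measurable_fun setT (fun t => KQ (t, x) A).
  exact: (measurableT_comp (measurable_kernel KQ _ mA) (pair2_measurable x)).
rewrite /random_time_kernel (eq_measure_integral (dirac (1 : R)))/=.
  rewrite (eq_integral (fun t => KQ (t, x) A)).
    rewrite integral_dirac//; last exact: measurable_funTS.
    by rewrite diracE mem_set ?mul1e//= in_itv/= andbT.
  by move=> t; rewrite inE/= in_itv/= andbT => /QE.
move=> B mB _.
have msB : measurable (sigma @^-1` B).
  exact: measurable_funPTI.
(* The law of [sigma] is the Dirac mass at 1: almost surely [sigma] lies in [B] exactly when 1 does,
   and this event is either everything or empty. *)
transitivity (Pr1 [set _ | B 1]).
  apply: (@ae_eqset_measure _ _ _ Pr1 (sigma @^-1` B)) => //.
    have [B1|B1] := pselect (B 1).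
      by rewrite (_ : mkset _ = setT)//; apply/seteqP; split.
    by rewrite (_ : mkset _ = set0)//; apply/seteqP; split.
  by apply: filterS sigma1 => w /= ->.
rewrite diracE; have [B1|B1] := pselect (B 1).
  by rewrite mem_set// (_ : mkset _ = setT) ?probability_setT//; apply/seteqP; split.
by rewrite memNset// (_ : mkset _ = set0) ?measure0//; apply/seteqP; split.
Qed.

Theorem theorem3 (R : realType)
  (d d' : measure_display) (V : measurableType d) (V' : measurableType d')
  (P : R -> R.-pker V ~> V) (P' : R -> R.-pker V' ~> V')
  (dO : measure_display) (Omega : measurableType dO)
  (Pr : probability Omega R) (tau : {RV Pr >-> R})
  (dS : measure_display) (OmegaS : measurableType dS)
  (PrS : probability OmegaS R) (X : R -> {RV PrS >-> R}) :
  markov_semigroup P -> markov_semigroup P' ->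
  interweaving P P' tau ->
  infinitely_divisible tau ->
  subordinator X -> same_law PrS Pr (X 1) tau ->
  [/\ exists Q : R -> R.-pker V ~> V, subordinated P X Q,
      exists Q' : R -> R.-pker V' ~> V', subordinated P' X Q'
    & forall (Q : R -> R.-pker V ~> V) (Q' : R -> R.-pker V' ~> V'),
        subordinated P X Q -> subordinated P' X Q' ->
        [/\ markov_semigroup Q, markov_semigroup Q'
          & interweaving_deterministic Q Q' 1]].
Proof.
move=> sgP sgP' PP' _ subX X1tau.
have [mu muE] := subordinator_law_kernel subX.
have [K [KQ kerP]] := subordination_kernels_exist mu sgP.
have [K' [KQ' kerP']] := subordination_kernels_exist mu sgP'.
split.
- exact: (subordinated_exists subX muE kerP).
- exact: (subordinated_exists subX muE kerP').
move=> Q Q' subQ subQ'; split.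
- exact: (subordinated_semigroup subX muE kerP).
- exact: (subordinated_semigroup subX muE kerP').
exact: (subordinated_interweaving_deterministic sgP sgP' PP' subX X1tau).
Qed.
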